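(* Let $c,h,t$ be positive integers with $c,t\geq 2$, and let $n=c^{\tau c(t-1)}-1$, where $$\tau=2^{c^{3cht}-c^{3ct}}.$$ Let $V$ be a finite set and let $(G_1,\ldots,G_c)$ be a $c$-multicoloring of $E(K_V)$. For each $i\in\{1,\ldots,c\}$, let $\mathscr{L}_i$ be a nonempty list of at most $t$ nonempty classes of nonnull graphs on at most $h$ vertices, such that $G_i$ has no $\mathscr{L}_i$-complete induced subgraph. Then $V$ is the union of $n$ sets $V_1,\ldots,V_n$ such that for every $j\in\{1,\ldots,n\}$, either $|V_j|=1$ or there exists $i\in\{1,\ldots,c\}$ such that $G_i[V_j]$ is $\mathcal{H}$-free for some class $\mathcal{H}$ from the list $\mathscr{L}_i$.
   Context: Graphs are finite and simple (no loops or parallel edges). A graph is nonnull if its vertex set is nonempty. For a graph $G$ and $X\subseteq V(G)$, $G[X]$ is the subgraph of $G$ induced by $X$. A copy of a graph $H$ in $G$ is an induced subgraph of $G$ isomorphic to $H$; $G$ is $H$-free if there is no copy of $H$ in $G$. A class is a set of graphs taken up to isomorphism. For a class $\mathcal{H}$, a graph $G$ is $\mathcal{H}$-free if $G$ is $H$-free for all $H\in\mathcal{H}$. $K_V$ denotes the complete graph with vertex set $V$. For $c\geq 2$, a $c$-multicoloring of $E(K_V)$ is a $c$-tuple $(G_1,\ldots,G_c)$ of graphs, each with vertex set $V$, such that $E(G_1)\cup\cdots\cup E(G_c)=E(K_V)$ (the edge sets may overlap). The complete join of graphs $H_1,\ldots,H_s$ (with $s\geq 1$) is the graph $H$ whose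 vertex set is the union of $s$ pairwise disjoint sets $X_1,\ldots,X_s$ such that $H[X_i]$ is isomorphic to $H_i$ for every $i\in\{1,\ldots,s\}$, and for all distinct $i,j\in\{1,\ldots,s\}$, every vertex in $X_i$ is adjacent in $H$ to every vertex in $X_j$. For a list $\mathscr{L}=(\mathcal{H}_1,\ldots,\mathcal{H}_s)$ of $s\geq 1$ nonempty classes of nonnull graphs, an $\mathscr{L}$-complete graph is the complete join of graphs $H_1,\ldots,H_s$ for some $(H_1,\ldots,H_s)\in\mathcal{H}_1\times\cdots\times\mathcal{H}_s$. The sets $V_1,\ldots,V_n$ are not required to be disjoint, distinct or nonempty. *)

(* Defs.v *)
From mathcomp Require Import all_boot.

Set Implicit Arguments.
Unset Strict Implicit.
Unset Printing Implicit Defensive.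

Record graph_on (V : finType) := GraphOn {
  adj : rel V;
  adj_sym : symmetric adj;
  adj_irrefl : irreflexive adj }.

Record graph := Graph {
  vertex :> finType;
  graph_str :> graph_on vertex }.

Definition isomorphic (V W : finType) (G : graph_on V) (H : graph_on W) : Prop :=
  exists f : V -> W,
    bijective f /\ forall x y, adj H (f x) (f y) = adj G x y.

Section Induced.
Variables (V : finType) (G : graph_on V) (X : {set V}).

Definition induced_adj : rel {x | x \in X} := fun u v => adj G (val u) (val v).

Fact induced_adj_sym : symmetric induced_adj.
Proof. by move=> u v; rewrite /induced_adj adj_sym. Qed.

Fact induced_adj_irrefl : irreflexive induced_adj.
Proof. by move=> u; rewrite /induced_adj adj_irrefl. Qed.

Definition induced : graph_on {x | x \in X} :=
  GraphOn induced_adj_sym induced_adj_irrefl.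
End Induced.

Definition graph_free (V : finType) (G : graph_on V) (H : graph) : Prop :=
  ~ exists X : {set V}, isomorphic (induced G X) H.

(* Closure under isomorphism is not required: every use of a class below goes
   through [isomorphic], so a predicate and its isomorphism closure give the
   same notions. *)
Definition graph_class := graph -> Prop.

Definition class_free (V : finType) (G : graph_on V) (C : graph_class) : Prop :=
  forall H, C H -> graph_free G H.

Definition multicoloring (c : nat) (V : finType) (G : 'I_c -> graph_on V) : Prop :=
  forall x y : V, x != y -> exists i, adj (G i) x y.

Definition complete_join (s : nat) (H : 'I_s -> graph)
    (V : finType) (J : graph_on V) : Prop :=
  exists X : 'I_s -> {set V},
    [/\ \bigcup_(i < s) X i = [set: V],
        forall i j, i != j -> [disjoint X i & X j],
        forall i, isomorphic (induced J (X i)) (H i)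
      & forall i j, i != j ->
          forall x y, x \in X i -> y \in X j -> adj J x y].

(* A list of length [s] is a family indexed by ['I_s]. *)
Definition class_list (s : nat) := 'I_s -> graph_class.

Definition list_complete (s : nat) (L : class_list s)
    (V : finType) (J : graph_on V) : Prop :=
  exists H : 'I_s -> graph, (forall i, L i (H i)) /\ complete_join H J.

Definition tau (c h t : nat) : nat :=
  2 ^ (c ^ (3 * c * h * t) - c ^ (3 * c * t)).

(* Main.v *)
Require Import Defs.
From mathcomp Require Import all_boot.
From mathcomp Require Import boolp zify.

Set Implicit Arguments.
Unset Strict Implicit.
Unset Printing Implicit Defensive.

(** Call a set _good_ if it is a singleton or one of the induced graphs on it is
free of one of the prescribed classes, and call a set _large_ (at level [m]) if
it is not covered by [m] good sets. A large set contains, in every colour [i],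
a copy of a member of every class of the [i]-th list. Suppose that the whole
vertex set is large. The claim is that one can peel off classes one at a time:
given one class [C i] for each colour, every large [W] contains, for some [i],
a copy [X] in [G i] of a member of [C i] such that the set of vertices of [W]
that are [G i]-complete to [X] is still large ([progress_step]). After at most
[c * t] such steps the list of some colour is used up, and the copies that were
chosen along the way in that colour form a forbidden complete join
([not_covered_joinable], [joinable_list_complete]).

To prove the claim, assume that it fails for [W]. Let [A] and [B] be large
subsets of [W]. If all [a] in [A] had only a small set of [G i]-nonneighbours in
[B], then [A] would contain a copy of a member of [C i], and almost all of [B]
would be complete to it. So some vertex of [A] has many nonneighbours in [B],
and this for every colour ([splits_nonnbrs]). Large [G i]-neighbourhoods need
not exist for a given [i], since a colour may be almost absent between [A] and
[B]. Call [i] _dead_ for [(A, B)] if every vertex of [A] has a small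
[G i]-neighbourhood in [B]. Every vertex of [A] is joined to every other vertex
of [B] in some colour, so not all colours are dead ([some_color_survives]).

Take many sets, all equal to [W], and shrink them as long as this can make a
further colour dead for some pair of them; each shrinking keeps all sets large
compared with the deadness thresholds, so no dead colour revives, and only
boundedly many shrinkings occur. When no more is possible, each pair of sets has a colour that is not dead, even
after passing to large subsets. By Ramsey's theorem ([ramsey_seq]) there are
[h.+1] of the sets for which this colour is a constant [i]. Both adjacency and
nonadjacency in [G i] then leave large sets, so any graph on at most [h]
vertices embeds greedily in [G i], one vertex in each of the sets, with a large
set left over that is complete to the copy ([greedy_embedding]). Applied to a
member of [C i], this contradicts the failure of the claim
([no_dense_system]).

Each shrinking raises the level required of the sets to about its [h]-th power,
and there are at most [c ^ (2 * c * h + 1)] of them, which gives a bound far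
below the stated one when [1 < h] ([level_lt_bound]). When [h = 1] the
exponent [tau] is [1] and the statement is exactly Ramsey's theorem for cliques,
so that [ramsey_seq] has to be proved with the sharp bound
[c ^ (c * (t - 1))]. *)

(** * Ramsey's theorem for ordered sequences *)

(** The pairs are taken in the order of the sequence, so that the colour relations
need not be symmetric. The head of the sequence has a colour to at least
[c ^ (n - 1)] of the at least [c ^ n - 1] other entries; this is where
[1 < c] is used. *)
Lemma ramsey_seq (c : nat) (T : eqType) (e : 'I_c -> rel T) (k : 'I_c -> nat)
    (xs : seq T) :
  1 < c -> pairwise (fun x y => [exists i, e i x y]) xs ->
  c ^ (\sum_i k i) <= size xs ->
  exists i ys, [/\ subseq ys xs, size ys = (k i).+1 & pairwise (e i) ys].
Proof.
move=> c_gt1; move En: (\sum_i k i) => n.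
elim: n k xs En => [|n IH] k [|x xs] En /=; rewrite ?leqn0 ?expn_eq0; try lia.
  move=> _ _; exists (Ordinal (ltnW c_gt1)), [:: x].
  split=> //=; first by rewrite eqxx sub0seq.
  by move/eqP: En; rewrite sum_nat_eq0 => /forallP/(_ (Ordinal (ltnW c_gt1)))/eqP ->.
move=> /andP[/allP xP xsP] sz.
case: (pselect (exists i, k i = 0)) => [[i ki0]|kpos].
  exists i, [:: x]; split=> //=; first by rewrite eqxx sub0seq.
  by rewrite ki0.
have [i le_i]: exists i, c ^ n <= count (e i x) xs.
  apply: contrapT => small.
  have : size xs <= \sum_(i < c) (c ^ n).-1.
    apply: (@leq_trans (\sum_i count (e i x) xs)).
      rewrite -sum1_size; under [leqRHS]eq_bigr do rewrite -sum1_count big_mkcond.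
      rewrite exchange_big /= big_seq [leqRHS]big_seq; apply: leq_sum => y /xP.
      by move=> /existsP[i ei]; rewrite (bigD1 i) //= ei.
    apply: leq_sum => i _; rewrite -ltnS prednK ?expn_gt0 ?(ltnW c_gt1) // ltnNge.
    by apply/negP => ?; apply: small; exists i.
  rewrite sum_nat_const card_ord => le_sz.
  have : 0 < c ^ n by rewrite expn_gt0 (ltnW c_gt1).
  move: sz le_sz; rewrite expnS; case: (c ^ n) => // q; nia.
have ki : 0 < k i by rewrite lt0n; apply/negP=> /eqP ?; apply: kpos; exists i.
pose k' j := if j == i then (k i).-1 else k j.
have En' : \sum_j k' j = n.
  move: En; rewrite (bigD1 i) //= [in X in _ -> X](bigD1 i) //= /k' eqxx.
  rewrite [X in _ -> _ + X = _](eq_bigr k); first by lia.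
  by move=> j /negbTE ->.
have [||j [ys [sub_ys sz_ys pw_ys]]] := IH k' (filter (e i x) xs) En'.
- by rewrite pairwise_filter.
- by rewrite size_filter.
have sub' : subseq ys xs := subseq_trans sub_ys (filter_subseq _ _).
case: (eqVneq j i) sz_ys pw_ys => [->|ne] sz_ys pw_ys; last first.
  exists j, ys; split=> //; last by rewrite sz_ys /k' (negbTE ne).
  exact: subseq_trans sub' (subseq_cons _ _).
exists i, (x :: ys); split=> /=; first by rewrite eqxx.
  by rewrite sz_ys /k' eqxx prednK.
rewrite pw_ys andbT; apply/allP => y /(mem_subseq sub_ys).
by rewrite mem_filter => /andP[].
Qed.

(** * Copies and complete joins *)

Section Copies.
Variables (V : finType) (G : graph_on V).

Definition is_copy (H : graph) (X : {set V}) : Prop :=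
  exists f : H -> V, [/\ injective f,
    forall x y, adj G (f x) (f y) = adj H x y & X = f @: [set: H]].

Definition realizes (C : graph_class) (X : {set V}) : Prop :=
  exists2 H, C H & is_copy H X.

Definition nbrs (b : bool) (a : V) : {set V} :=
  [set v | (v != a) && (adj G a v == b)].

Definition common_nbrs (X : {set V}) : {set V} :=
  [set v | [forall x in X, adj G x v]].

Lemma copy_card H X : is_copy H X -> #|X| = #|H|.
Proof. by case=> f [f_inj _ ->]; rewrite card_imset // cardsT. Qed.

Lemma not_class_free_realizes (A : {set V}) (C : graph_class) :
  ~ class_free (induced G A) C -> exists2 X : {set V}, X \subset A & realizes C X.
Proof.
move=> /existsNP[H /not_implyP[CH]] /contrapT[Y [f [[g fK gK] adj_f]]].
pose g' (u : H) : V := val (val (g u)).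
exists (g' @: [set: H]).
  by apply/subsetP => _ /imsetP[u _ ->]; exact: valP (val (g u)).
exists H => //; exists g'; split=> // [x y|x y]; last first.
  by rewrite -{2}(gK x) -{2}(gK y) adj_f.
by move=> /val_inj/val_inj; exact: can_inj gK x y.
Qed.

Lemma is_copy_iso (Y X : {set V}) H : X \subset Y -> is_copy H X ->
  isomorphic (induced (induced G Y) [set u | val u \in X]) H.
Proof.
move=> XY [f [f_inj adj_f defX]].
have fX u : f u \in X by rewrite defX imset_f.
have f_surj v : v \in X -> exists u, v = f u.
  by rewrite defX => /imsetP[u _ ->]; exists u.
pose fY u : {x | x \in Y} := exist _ (f u) (subsetP XY _ (fX u)).
have fYX u : fY u \in [set u | val u \in X] by rewrite inE; exact: fX.
pose g u : {u | u \in [set u : {x | x \in Y} | val u \in X]} :=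
  exist _ (fY u) (fYX u).
have g_surj (w : {u | u \in [set u : {x | x \in Y} | val u \in X]}) :
    exists u, g u = w.
  have wX : val (val w) \in X by have := valP w; rewrite inE.
  have [u eq_u] := f_surj _ wX.
  by exists u; apply: val_inj; apply: val_inj; rewrite /= eq_u.
have [g' g'K] := fin_all_exists g_surj.
have g_inj : injective g by move=> u v /(congr1 (fun w => val (val w))) /f_inj.
exists g'; split; last first.
  by move=> x y; rewrite -adj_f -{2}(g'K x) -{2}(g'K y).
by exists g => // u; apply: g_inj; rewrite g'K.
Qed.

Section Join.
Variables (K : finType) (C : K -> graph_class).

(** A complete join found greedily: each class is realized inside the common
neighbourhood of the copies chosen before. *)
Fixpoint joinable (ks : seq K) (W : {set V}) : Prop :=
  if ks is k :: ks' then
    exists X : {set V}, [/\ X \subset W, realizes (C k) X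
                & joinable ks' (common_nbrs X :&: W)]
  else True.

Lemma joinable_sub ks (W W' : {set V}) :
  W \subset W' -> joinable ks W -> joinable ks W'.
Proof.
elim: ks W W' => //= k ks IH W W' sub [X [XW CX J]].
exists X; split=> //; first exact: subset_trans sub.
by apply: IH J; rewrite setIS.
Qed.

Lemma joinable_parts ks W : uniq ks -> joinable ks W ->
  exists X : K -> {set V},
    (forall k, k \in ks -> X k \subset W /\ realizes (C k) (X k)) /\
    {in ks &, forall k l, k != l -> forall x y, x \in X k -> y \in X l ->
       adj G x y}.
Proof.
elim: ks W => [|k ks IH] W /=; first by exists (fun=> set0).
move=> /andP[k_ks uks] [X0 [X0W CX0 /(IH _ uks)[X [XP Xcomp]]]].
exists (fun l => if l == k then X0 else X l); split.
  move=> l; rewrite inE; case: eqP => [-> //|_ /= /XP[XlW ?]]; split=> //.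
  exact: subset_trans XlW (subsetIr _ _).
have cross l x y : l \in ks -> x \in X0 -> y \in X l -> adj G x y.
  move=> /XP[/subsetP XlW _] xX /XlW; rewrite !inE => /andP[/forall_inP + _].
  exact.
move=> l l'; rewrite !inE.
case: (eqVneq l k) => [->|_]; case: (eqVneq l' k) => [->|_] //=;
  rewrite ?eqxx //.
- by move=> _ + _ x y; exact: cross.
- by move=> + _ _ x y xl y0; rewrite adj_sym; move/cross; apply.
- exact: Xcomp.
Qed.

End Join.

Lemma joinable_list_complete (s : nat) (L : class_list s) (W : {set V}) :
  joinable L (enum 'I_s) W -> exists X, list_complete L (induced G X).
Proof.
move=> /(joinable_parts (enum_uniq _))[X [XP Xcomp]].
have {XP}/fin_all_exists[H HP] k : exists H, L k H /\ is_copy H (X k).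
  by have [_ [H ? ?]] := XP k (mem_enum _ k); exists H.
exists (\bigcup_k X k), H; split=> [k|]; first by have [] := HP k.
have subX k : X k \subset \bigcup_k X k by rewrite (bigcup_sup k).
exists (fun k => [set u | val u \in X k]); split.
- apply/setP => u; rewrite inE; apply/bigcupP.
  by have /bigcupP[k _ uk] := valP u; exists k; rewrite ?inE.
- move=> k l kl; rewrite -setI_eq0; apply/eqP/setP => u; rewrite !inE.
  apply/negbTE/negP => /andP[uk ul].
  by have := Xcomp k l (mem_enum _ _) (mem_enum _ _) kl _ _ uk ul; rewrite adj_irrefl.
- by move=> k; apply: is_copy_iso => //; have [] := HP k.
move=> k l kl x y; rewrite !inE => xk yl.
exact: (Xcomp k l (mem_enum _ _) (mem_enum _ _) kl _ _ xk yl).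
Qed.

End Copies.

(** * Covers by good sets *)

Section Covers.
Variables (V : finType) (good : {set V} -> Prop).
Hypothesis good1 : forall a, good [set a].

Definition covered (n : nat) (A : {set V}) : Prop :=
  exists Ps : seq {set V}, [/\ size Ps <= n, forall P, P \in Ps -> good P
    & A \subset \bigcup_(P <- Ps) P].

Lemma covered_sub m n (A B : {set V}) :
  m <= n -> A \subset B -> covered m B -> covered n A.
Proof.
move=> mn AB [Ps [sz gd sub]]; exists Ps; split=> //; first exact: leq_trans mn.
exact: subset_trans sub.
Qed.

Lemma covered0 : covered 0 set0.
Proof. by exists [::]; split=> //; rewrite big_nil. Qed.

Lemma coveredU m n (A B : {set V}) :
  covered m A -> covered n B -> covered (m + n) (A :|: B).
Proof.
move=> [Ps [szP gP subP]] [Qs [szQ gQ subQ]]; exists (Ps ++ Qs); split.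
- by rewrite size_cat leq_add.
- by move=> P; rewrite mem_cat => /orP[/gP|/gQ].
- by rewrite big_cat setUSS.
Qed.

Lemma covered_bigcup (I : finType) (r : seq I) (F : I -> {set V}) n :
  (forall i, i \in r -> covered n (F i)) ->
  covered (size r * n) (\bigcup_(i <- r) F i).
Proof.
elim: r => [_|i r IH cF]; first by rewrite big_nil; exact: covered0.
rewrite big_cons mulSn; apply: coveredU; first by apply: cF; rewrite mem_head.
by apply: IH => j jr; apply: cF; rewrite inE jr orbT.
Qed.

Lemma covered_card (A : {set V}) : covered #|A| A.
Proof.
exists [seq [set a] | a <- enum A]; split; first by rewrite size_map cardE.
  by move=> _ /mapP[a _ ->].
rewrite big_map bigcup_seq; apply/subsetP => a aA; apply/bigcupP.
by exists a; rewrite ?inE ?mem_enum.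
Qed.

Lemma not_covered_mem n (A : {set V}) : ~ covered n A -> exists a, a \in A.
Proof.
move=> nA; apply/set0Pn/eqP => A0; apply: nA; rewrite A0.
exact: covered_sub covered0.
Qed.

Lemma not_covered_not_good n (A : {set V}) : 0 < n -> ~ covered n A -> ~ good A.
Proof.
move=> n0 nA gA; apply: nA; exists [:: A]; split=> //.
  by move=> P; rewrite inE => /eqP->.
by rewrite big_seq1.
Qed.

End Covers.

(** * Levels of largeness *)

(** [level c h k * m] is the level at which a system of sets must be large when [k]
colours of pairs may still die, and [m] bounds the neighbourhoods for the dead
ones. A greedy embedding makes [h] choices, each of which avoids at most [h]
exceptional sets whose covering number is that of the case [k - 1]; this gives
the factor [h * level c h k'] for each choice. *)
Fixpoint level (c h k : nat) : nat :=
  if k is k'.+1 then (h * level c h k') ^ h else c ^ (2 * h).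

Lemma level_ge c h k : 1 < c -> 0 < h ->
  c.+1 <= level c h k /\ (2 * h).+1 <= level c h k.
Proof.
move=> c_gt1 h_gt0; elim: k => [|k [IH1 IH2]] /=.
  rewrite mulnC expnM; have := ltn_expl h (isT : 1 < 2).
  have : c <= c ^ h by rewrite -{1}(expn1 c) leq_exp2l.
  have : 2 ^ h <= c ^ h by rewrite leq_exp2r.
  rewrite !expnS expn0; nia.
have : level c h k <= (h * level c h k) ^ h.
  apply: (@leq_trans (h * level c h k)); first by rewrite leq_pmull.
  by rewrite -{1}(expn1 (h * _)) leq_pexp2l //; nia.
by split; lia.
Qed.

Lemma level_le c h k : 1 < c -> 0 < h ->
  level c h k <= c ^ ((2 * h) ^ k.+1).
Proof.
move=> c_gt1 h_gt0; elim: k => [|k IH] /=; first by rewrite expn1.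
have h_le : h <= c ^ h := ltnW (ltn_expl h c_gt1).
apply: (@leq_trans ((c ^ h * c ^ ((2 * h) ^ k.+1)) ^ h)).
  by rewrite leq_exp2r // leq_mul.
rewrite -expnD -expnM leq_exp2l // [X in _ <= X]expnS.
have : (2 * h) ^ 1 <= (2 * h) ^ k.+1 by rewrite leq_pexp2l // muln_gt0.
nia.
Qed.

(** Here [d] counts the triples of two indices and one colour, and the outer exponent
[c * t] bounds the number of peeling steps. Since [t <= 2 * (t - 1)], it
suffices to bound [2 * (2 * h) ^ d.+1], whose binary logarithm is at most
[(h * d.+1).+1], while that of [tau c h t] is at least [c ^ (3 * c * h * t - 1)]. *)
Lemma level_lt_bound c h t : 1 < c -> 1 < h -> 1 < t ->
  level c h (c ^ (c * h) * c ^ (c * h) * c) ^ (c * t)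
    < c ^ (tau c h t * c * (t - 1)).
Proof.
move=> c_gt1 h_gt1 t_gt1; have h_gt0 := ltnW h_gt1.
set d := _ * c; apply: (@leq_ltn_trans (c ^ ((2 * h) ^ d.+1 * (c * t)))).
  by rewrite [leqRHS]expnM leq_exp2r ?level_le // muln_gt0; lia.
rewrite ltn_exp2l //.
suff : 2 * (2 * h) ^ d.+1 < tau c h t.
  set u := _ ^ _; set v := tau _ _ _ => uv.
  have t_le : t <= 2 * (t - 1) by lia.
  rewrite mulnCA [v * c]mulnC -mulnA ltn_pmul2l; last by lia.
  apply: leq_ltn_trans (leq_mul (leqnn u) t_le) _.
  by rewrite mulnA [u * 2]mulnC ltn_pmul2r //; lia.
have two_h : 2 * h <= 2 ^ h.
  have [j ->] : exists j, h = j.+2 by exists h.-2; lia.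
  have := ltn_expl j.+1 (isT : 1 < 2); rewrite [2 ^ j.+2]expnS; lia.
apply: (@leq_ltn_trans (2 ^ (h * d.+1).+1)).
  by rewrite [leqRHS]expnS leq_mul2l /= [leqRHS]expnM leq_exp2r.
rewrite /tau ltn_exp2l //.
have d_le : d = c ^ (2 * c * h).+1.
  by rewrite /d -expnD -expnSr; congr (c ^ _); lia.
have hc : h < c ^ h := ltn_expl h c_gt1.
have lhs : (h * d.+1).+2 <= c ^ (h + (2 * c * h).+1).+2.
  have h_d : h <= d.
    apply: leq_trans (ltnW hc) _; rewrite d_le leq_exp2l //.
    by apply: leqW; rewrite leq_pmull //; lia.
  rewrite 2![c ^ _.+1]expnS expnD -d_le.
  have : h.+1 * d <= c ^ h * d by rewrite leq_mul2r hc orbT.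
  have : 2 * (2 * (c ^ h * d)) <= c * (c * (c ^ h * d)) by rewrite !leq_mul.
  nia.
have -> : 3 * c * h * t = (3 * c * h * t).-1.+1 by rewrite prednK //; nia.
have small : c ^ (3 * c * t) <= c ^ (3 * c * h * t).-1.
  by rewrite leq_exp2l //; nia.
have big : c ^ (h + (2 * c * h).+1).+2 <= c ^ (3 * c * h * t).-1.
  rewrite leq_exp2l //; nia.
rewrite expnS; nia.
Qed.

(** * Peeling off one class *)

Section Step.
Variables (c h : nat) (V : finType) (G : 'I_c -> graph_on V).
Variables (good : {set V} -> Prop) (C : 'I_c -> graph_class).
Hypotheses (c_gt1 : 1 < c) (h_gt0 : 0 < h) (G_col : multicoloring G).
Hypothesis good1 : forall a, good [set a].
Hypothesis C_nonempty : forall i, exists H, C i H.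
Hypothesis C_card : forall i H, C i H -> #|H| <= h.
Hypothesis realizes_of_not_good : forall i (A : {set V}),
  ~ good A -> exists2 X : {set V}, X \subset A & realizes (G i) (C i) X.

Local Notation cov := (covered good).

(** Quantifying over all large subsets of [P] and [Q] makes the property survive the
shrinking of candidate sets during an embedding. *)
Definition splits (x y : nat) (i : 'I_c) (b : bool) (P Q : {set V}) : Prop :=
  forall A B : {set V}, A \subset P -> B \subset Q -> ~ cov y A -> ~ cov y B ->
  exists2 a, a \in A & ~ cov x (B :&: nbrs (G i) b a).

(** In a splitting pair almost all vertices of [A] have a large neighbourhood, as the
exceptional ones could otherwise take the place of [A]. This lets one vertex
serve several pairs at once. *)
Lemma splits_exceptions x y i b (P Q A B : {set V}) : splits x y i b P Q ->
  A \subset P -> B \subset Q -> ~ cov y B ->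
  cov y [set a in A | `[< cov x (B :&: nbrs (G i) b a) >]].
Proof.
move=> spl AP BQ nB; apply: contrapT => nA.
have [|a] := spl _ B _ BQ nA nB.
  by apply: subset_trans AP; apply/subsetP => a; rewrite inE => /andP[].
by rewrite inE => /andP[_ /asboolP].
Qed.

Section NoProgress.
Variables (N : nat) (W : {set V}).
Hypothesis N_gt0 : 0 < N.
Hypothesis no_progress : forall i (X : {set V}), X \subset W ->
  realizes (G i) (C i) X -> cov N (common_nbrs (G i) X :&: W).

(** Otherwise [B] would be covered by the common neighbours of a copy [X] inside [A],
the nonneighbourhoods of the vertices of [X], and [X] itself: in total
[N + h * x + h <= (2 * h).+1 * x] good sets. *)
Lemma splits_nonnbrs x y i : N <= x -> (2 * h).+1 * x <= y ->
  splits x y i false W W.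
Proof.
move=> Nx xy A B AW BW nA nB; apply: contrapT => small.
have y_gt0 : 0 < y by nia.
have [X XA CX] := realizes_of_not_good i (not_covered_not_good y_gt0 nA).
have X_card : #|X| <= h by case: CX => H /C_card + /copy_card ->.
have covX a : a \in enum X -> cov x (B :&: nbrs (G i) false a).
  rewrite mem_enum => /(subsetP XA) aA.
  by apply: contrapT => ?; apply: small; exists a.
have := coveredU (no_progress (subset_trans XA AW) CX)
          (coveredU (covered_bigcup covX) (covered_card good1 X)).
rewrite -cardE => /(covered_sub (n := y) (A := B)) cB; apply/nB/cB; first by nia.
apply/subsetP => v vB; rewrite !inE (subsetP BW _ vB) andbT.
case: forallP => //= /forallP/forallPn[a].
rewrite negb_imply => /andP[aX nadj].
case vX: (v \in X); rewrite ?orbT //= orbF.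
rewrite bigcup_seq; apply/bigcupP; exists a; rewrite ?mem_enum //.
by rewrite !inE vB (negbTE nadj) eqxx andbT; apply: contraFN vX => /eqP->.
Qed.

Section Embedding.
Variables (i : 'I_c) (H : graph) (S : option H -> {set V}).
Variables (x y : nat -> nat) (alive : rel (option H)).
Hypothesis levels : forall r, h * y r <= x r.+1.
Hypothesis alive_splits : forall o o' r b, alive o o' -> r < h ->
  splits (x r) (y r) i b (S o) (S o').

(** The role [None] stands for the set that is left over, which must be complete to the
copy of [H]; [Some u] is the role of the vertex [u]. *)
Definition role_adj (o o' : option H) : bool :=
  if (o, o') is (Some u, Some v) then adj H u v else true.

(** Each chosen vertex replaces the candidate sets of the later roles by its
neighbourhood or its nonneighbourhood in them, and their level drops from
[x r.+1] to [x r], where [r] is the number of vertices still to be chosen.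
There are at most [h] later roles, so at most [h * y r <= x r.+1] good sets cover
the vertices that cannot be chosen. *)
Lemma greedy_embedding (us : seq H) (B : option H -> {set V}) :
  size us <= h -> uniq us -> pairwise alive (rcons (map Some us) None) ->
  (forall o, o \in rcons (map Some us) None ->
     B o \subset S o /\ ~ cov (x (size us)) (B o)) ->
  exists (g : H -> V) (A : {set V}), [/\ A \subset B None, ~ cov (x 0) A,
    forall u, u \in us -> g u \in B (Some u) /\ A \subset nbrs (G i) true (g u)
  & {in us &, forall u v, u != v ->
       g u != g v /\ adj (G i) (g u) (g v) = adj H u v}].
Proof.
elim: us B => [|u us IH] B /=.
  move=> _ _ _ BP; have [_ nB] := BP None (mem_head _ _).
  by have [v _] := not_covered_mem nB; exists (fun=> v), (B None).
move=> sz /andP[u_us us_uniq] /andP[/allP alive_u alive_us] BP.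
set rest := rcons _ _ in alive_u alive_us BP.
have rest_sz : size rest = (size us).+1 by rewrite size_rcons size_map.
have lev := levels (size us).
have [BuS nBu] := BP (Some u) (mem_head _ _).
pose B' a o := B o :&: nbrs (G i) (role_adj (Some u) o) a.
have [a aB aP] : exists2 a, a \in B (Some u) &
    forall o, o \in rest -> ~ cov (x (size us)) (B' a o).
  apply: contrapT => noa; apply: nBu.
  pose bad o := [set a in B (Some u) | `[< cov (x (size us)) (B' a o) >]].
  have bad_cov o : o \in rest -> cov (y (size us)) (bad o).
    move=> o_rest; have [|BoS nBo] := BP o; first by rewrite inE o_rest orbT.
    apply: splits_exceptions BuS BoS _; first exact/alive_splits/sz/alive_u.
    move=> cBo; apply: nBo; apply: covered_sub cBo => //.
    by apply: leq_trans lev; rewrite leq_pmull.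
  apply: covered_sub (covered_bigcup bad_cov).
    by apply: leq_trans lev; rewrite rest_sz leq_mul2r sz orbT.
  apply/subsetP => a aB; apply: contrapT => a_ok; apply: noa; exists a => // o oR.
  move=> cB'; apply: a_ok; rewrite bigcup_seq; apply/bigcupP; exists o => //.
  by rewrite inE aB; apply/asboolP.
have [|//|//||g [A [AB nA gP gadj]]] := IH (B' a); first exact: ltnW.
  move=> o oR; split; last exact: aP.
  have [|BoS _] := BP o; first by rewrite inE oR orbT.
  by apply: subset_trans BoS; exact: subsetIl.
have {AB} [AB An] : A \subset B None /\ A \subset nbrs (G i) true a.
  by apply/andP; rewrite -subsetI.
exists (fun v => if v == u then a else g v), A; split=> //.
  move=> v; rewrite inE; case: (eqVneq v u) => [-> _|_ /= vus]; first by split.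
  by have [+ ?] := gP v vus; rewrite inE => /andP[].
have cross v : v \in us -> a != g v /\ adj (G i) a (g v) = adj H u v.
  move=> /gP[+ _]; rewrite !inE => /and3P[_ + /eqP].
  by rewrite eq_sym.
move=> v w; rewrite !inE.
case: (eqVneq v u) => [->|_]; case: (eqVneq w u) => [->|_] //=;
  rewrite ?eqxx //.
- by move=> _ /cross.
- by move=> /cross[? ?] _ _; rewrite eq_sym adj_sym (adj_sym H).
- exact: gadj.
Qed.

End Embedding.

(** The neighbourhoods of one vertex in the [c] colours cover all the other vertices. *)
Lemma some_color_survives n m (A B : {set V}) : ~ cov n A -> ~ cov (c * m).+1 B ->
  exists i, exists2 a, a \in A & ~ cov m (B :&: nbrs (G i) true a).
Proof.
move=> nA nB; apply: contrapT => small; apply: nB.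
have [a aA] := not_covered_mem nA.
have covB i : i \in enum 'I_c -> cov m (B :&: nbrs (G i) true a).
  by move=> _; apply: contrapT => nBi; apply: small; exists i, a.
apply: covered_sub (coveredU (covered_card good1 [set a]) (covered_bigcup covB)).
  by rewrite cards1 size_enum_ord.
apply/subsetP => v vB; rewrite !inE; case: eqVneq => //= va.
have [i ai] := G_col va.
rewrite bigcup_seq; apply/bigcupP; exists i; rewrite ?mem_enum //.
by rewrite !inE vB va (adj_sym (G i)) ai.
Qed.

(** The triples in [D] are dead colours of ordered pairs of indices, with the common
threshold [m]. The induction is on the number [k] of triples outside [D]. When
a further colour dies in the course of the embedding, at stage [r], the new
threshold is [x r], and all sets are still large at level
[level c h k.-1 * x r]; it is essential that this level is far above the new
threshold, since otherwise deadness would lose its meaning when the sets shrink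
again. *)
Lemma no_dense_system (I : finType) k (P : I -> {set V})
    (D : {set I * I * 'I_c}) m :
  c ^ (c * h) <= #|I| -> N <= m -> #|~: D| = k ->
  (forall p, P p \subset W) -> (forall p, ~ cov (level c h k * m) (P p)) ->
  (forall p q i, (p, q, i) \in D ->
     forall a, a \in P p -> cov m (P q :&: nbrs (G i) true a)) -> False.
Proof.
move=> cardI; elim/ltn_ind: k P D m => k IH P D m Nm Dk PW nP dead.
have m_gt0 := leq_trans N_gt0 Nm.
have alive p q : exists i, (p, q, i) \notin D.
  have [|i [a ap nq]] := @some_color_survives (level c h k * m) m (P p) (P q) (nP p).
    move=> cq; apply: (nP q); apply: covered_sub cq => //.
    by have [+ _] := level_ge k c_gt1 h_gt0; nia.
  by exists i; apply/negP => /dead/(_ a ap).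
have [H CH] := fin_all_exists C_nonempty.
pose e i p q := ((p, q, i) \notin D) && (p != q).
have [||i [ps [_ sz_ps pw_ps]]] :=
    @ramsey_seq c _ e (fun i => #|H i|) (enum I) c_gt1.
- apply: sub_pairwise (_ : pairwise (fun x y => x != y) _); last first.
    by rewrite -uniq_pairwise enum_uniq.
  move=> p q pq; have [i piq] := alive p q.
  by apply/existsP; exists i; rewrite /e piq.
- rewrite -cardE; apply: leq_trans cardI; rewrite leq_exp2l //.
  rewrite -[in leqRHS](card_ord c) -sum_nat_const.
  by apply: leq_sum => i _; exact: C_card (CH i).
(* The sets indexed by [ps] receive the vertices of [F] in the order of [enum F];
   the last one receives the common neighbours. *)
have {}CH := CH i; set F := H i in CH sz_ps; have F_card := C_card CH.
have [p0 _] : exists p0, p0 \in ps.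
  by case: (ps) sz_ps => // p ps' _; exists p; exact: mem_head.
pose os := rcons (map Some (enum F)) None.
have os_uniq : uniq os.
  rewrite rcons_uniq map_inj_uniq ?enum_uniq ?andbT; last by move=> ? ? [].
  by apply/mapP => -[].
have sz_os : size os = size ps by rewrite size_rcons size_map -cardE.
pose role o := nth p0 ps (index o os).
have alive_os : pairwise (fun o o' => e i (role o) (role o')) os.
  rewrite -(pairwise_map role); suff -> : map role os = ps by [].
  apply: (@eq_from_nth _ p0); rewrite size_map // => j j_os.
  by rewrite (nth_map None) // /role index_uniq.
have k_gt0 : 0 < k.
  have [j nD] := alive p0 p0.
  by rewrite -Dk card_gt0; apply/set0Pn; exists (p0, p0, j); rewrite inE.
case: k k_gt0 => // k _ in IH Dk nP *.
have Q_gt0 : 0 < level c h k by have [+ _] := level_ge k c_gt1 h_gt0; lia.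
pose x r := (h * level c h k) ^ r * m; pose y r := level c h k * x r.
have x_mono r r' : r <= r' -> x r <= x r'.
  by move=> rr'; rewrite leq_mul2r leq_pexp2l ?rr' ?orbT // muln_gt0 h_gt0.
have m_x r : m <= x r by have := x_mono 0 r isT; rewrite /x expn0 mul1n.
have levels r : h * y r <= x r.+1 by rewrite /y /x expnS !mulnA.
have nPx r p : r <= h -> ~ cov (x r) (P p).
  by move=> rh cp; apply: (nP p); apply: covered_sub (x_mono _ _ rh) _ cp.
have spl o o' r b : e i (role o) (role o') -> r < h ->
    splits (x r) (y r) i b (P (role o)) (P (role o')).
  move=> /andP[nD pq] rh A B AP BQ nA nB.
  case: b; last first.
    have sub_W (Z : {set V}) p : Z \subset P p -> Z \subset W.
      by move=> ZW; exact: subset_trans (PW p).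
    apply: splits_nonnbrs (sub_W _ _ AP) (sub_W _ _ BQ) nA nB.
      exact: leq_trans (m_x r).
    by have [_ +] := level_ge k c_gt1 h_gt0; rewrite /y; nia.
  (* Otherwise the colour [i] dies on [(A, B)]: put these sets in place of those
     with indices [p] and [q] and use the induction hypothesis. *)
  apply: contrapT => small; set p := role o in nD pq AP.
  set q := role o' in nD pq BQ.
  pose P' t := if t == p then A else if t == q then B else P t.
  have P'_sub t : P' t \subset P t.
    by rewrite /P'; case: eqP => [->//|_]; case: eqP => [->//|_].
  apply: (IH k _ P' ((p, q, i) |: D) (x r)) => //.
  - exact: leq_trans (m_x r).
  - move: Dk; rewrite setCU setIC -setDE (cardsD1 (p, q, i)).
    by rewrite inE nD => -[].
  - by move=> t; exact: subset_trans (PW t).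
  - move=> t; rewrite /P'; case: eqP => // _; case: eqP => // _ ct.
    apply: (@nPx r.+1 t rh); apply: covered_sub ct => //.
    by apply: leq_trans (levels r); rewrite leq_pmull.
  - move=> p1 q1 i1; rewrite inE => /orP[|].
      rewrite inE => /eqP[-> -> ->] a; rewrite /P' eqxx.
      rewrite eq_sym (negbTE pq) eqxx => aA.
      by apply: contrapT => nc; apply: small; exists a.
    move=> /dead + a ap => /(_ a (subsetP (P'_sub _) _ ap)).
    by apply: covered_sub (m_x r) _; rewrite setSI.
have [|||g [A [AW nA gP gadj]]] := greedy_embedding levels spl (us := enum F)
    (B := fun o => P (role o)) _ _ alive_os _.
- by rewrite -cardE.
- exact: enum_uniq.
- by move=> o _; split=> //; apply: nPx; rewrite -cardE.
have gF u : g u \in P (role (Some u)) /\ A \subset nbrs (G i) true (g u).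
  by apply: gP; rewrite mem_enum.
apply: nA; apply: covered_sub (no_progress (i := i) (X := g @: [set: F]) _ _).
- exact: leq_trans (m_x 0).
- apply/subsetP => v vA; rewrite !inE (subsetP (PW _) _ (subsetP AW _ vA)) andbT.
  apply/forall_inP => _ /imsetP[u _ ->].
  by have [_ /subsetP/(_ v vA)] := gF u; rewrite inE => /andP[_ /eqP].
- apply/subsetP => _ /imsetP[u _ ->]; have [gu _] := gF u.
  exact: subsetP (PW _) _ gu.
exists F => //; exists g; split=> // [u v|u v].
  by apply: contra_eq => /(gadj u v (mem_enum _ _) (mem_enum _ _))[].
case: (eqVneq u v) => [->|]; first by rewrite !adj_irrefl.
by move=> /(gadj u v (mem_enum _ _) (mem_enum _ _))[].
Qed.
End NoProgress.

Lemma progress_step N (W : {set V}) : 0 < N ->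
  ~ cov (level c h (c ^ (c * h) * c ^ (c * h) * c) * N) W ->
  exists i (X : {set V}), [/\ X \subset W, realizes (G i) (C i) X
    & ~ cov N (common_nbrs (G i) X :&: W)].
Proof.
move=> N_gt0 nW; apply: contrapT => stuck.
apply: (@no_dense_system N W N_gt0 _ 'I_(c ^ (c * h)) _ (fun=> W) set0 N) => //.
- move=> i X XW CX; apply: contrapT => nX; apply: stuck.
  by exists i, X.
- by rewrite card_ord.
- by rewrite setC0 cardsT !card_prod !card_ord.
- by move=> p q i; rewrite inE.
Qed.

End Step.

(** * Peeling off all classes *)

Section Iteration.
Variables (c h : nat) (V : finType) (G : 'I_c -> graph_on V).
Variables (s : 'I_c -> nat) (L : forall i : 'I_c, class_list (s i)).
Arguments L : clear implicits.

Definition good (A : {set V}) : Prop :=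
  #|A| = 1 \/ exists (i : 'I_c) (k : 'I_(s i)), class_free (induced (G i) A) (L i k).

Lemma good1 a : good [set a]. Proof. by left; rewrite cards1. Qed.

Lemma realizes_of_not_good i (k : 'I_(s i)) (A : {set V}) :
  ~ good A -> exists2 X : {set V}, X \subset A & realizes (G i) (L i k) X.
Proof.
by move=> nA; apply: not_class_free_realizes => free; apply: nA; right; exists i, k.
Qed.

Hypothesis L_nonempty : forall i k, exists H : graph, L i k H.
Hypothesis L_size : forall i k (H : graph), L i k H -> 1 <= #|H| <= h.

(** When all members of the classes are single vertices, a complete join is a clique. *)
Lemma clique_joinable i (ks : seq 'I_(s i)) (xs : seq V) (W : {set V}) :
  h <= 1 -> size xs = size ks -> pairwise (adj (G i)) xs -> {subset xs <= W} ->
  joinable (G i) (L i) ks W.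
Proof.
move=> h_le1; elim: ks xs W => // k ks IH [|x xs] W //= [sz] /andP[/allP xP pw] xW.
exists [set x]; split.
- by rewrite sub1set xW ?mem_head.
- have [H LH] := L_nonempty k; exists H => //.
  have H1 : #|H| = 1 by have := L_size LH; lia.
  have uniqH (u v : H) : u = v.
    by have /fintype1P[u0 uP] : #|H| == 1 by [exact/eqP]; rewrite (uP u) (uP v).
  exists (fun=> x); split=> [u v _|u v|]; first exact: uniqH.
    by rewrite (uniqH u v) !adj_irrefl.
  have /card_gt0P[u _] : 0 < #|H| by rewrite H1.
  by apply/setP => v; rewrite inE; apply/eqP/imsetP => [->|[]//]; exists u.
apply: IH pw _ => // y y_xs; rewrite !inE xW ?inE ?y_xs ?orbT // andbT.
by apply/forall_inP => _ /set1P->; exact: xP.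
Qed.

Hypotheses (c_gt1 : 1 < c) (G_col : multicoloring G).

(** Each use of [progress_step], applied to the first remaining class of every colour,
shortens one of the lists, at the cost of one factor in the level. *)
Lemma not_covered_joinable n (ks : forall i, seq 'I_(s i)) (W : {set V}) :
  0 < h -> \sum_i size (ks i) <= n ->
  ~ covered good (level c h (c ^ (c * h) * c ^ (c * h) * c) ^ n) W ->
  exists i, joinable (G i) (L i) (ks i) W.
Proof.
move=> h_gt0; elim: n ks W => [|n IH] ks W.
  rewrite leqn0 sum_nat_eq0 => /forallP/(_ (Ordinal (ltnW c_gt1)))/nilP ks0 _.
  by exists (Ordinal (ltnW c_gt1)); rewrite ks0.
set Q := level _ _ _ => le_n nW.
case: (pselect (exists i, ks i = [::])) => [[i ksi]|ks_neq0].
  by exists i; rewrite ksi.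
have /fin_all_exists[k kP] i : exists k, ks i = k :: behead (ks i).
  case ksi: (ks i) => [|k ks']; last by exists k.
  by case: ks_neq0; exists i.
have Q_gt0 : 0 < Q.
  have [+ _] := level_ge (c ^ (c * h) * c ^ (c * h) * c) c_gt1 h_gt0.
  exact: leq_trans.
have [|||||i [X [XW CX nX]]] := @progress_step c h V G good (fun i => L i (k i))
    c_gt1 h_gt0 G_col good1 _ _ _ (Q ^ n) W.
- by move=> i; exact: L_nonempty.
- by move=> i H /L_size/andP[].
- by move=> i A; exact: realizes_of_not_good.
- by rewrite expn_gt0 Q_gt0.
- by rewrite -expnS.
pose ks' j := if j == i then behead (ks j) else ks j.
have [|j] := IH ks' _ _ nX.
  move: le_n; rewrite (bigD1 i) //= [in X in _ -> X](bigD1 i) //= /ks' eqxx.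
  rewrite {1}kP /= addSn ltnS; apply: leq_trans; rewrite leq_add2l.
  by apply: leq_sum => j /negbTE->.
rewrite /ks'; case: eqVneq => [->|_] J; last first.
  by exists j; apply: joinable_sub J; exact: subsetIr.
by exists i; rewrite kP; exists X.
Qed.

End Iteration.

Theorem theorem1p4 (c h t : nat) (hc : 2 <= c) (hh : 1 <= h) (ht : 2 <= t)
    (n : nat) (hn : n = c ^ (tau c h t * c * (t - 1)) - 1)
    (V : finType) (G : 'I_c -> graph_on V) (hG : multicoloring G)
    (s : 'I_c -> nat) (hs : forall i, 1 <= s i <= t)
    (L : forall i : 'I_c, class_list (s i))
    (L_nonempty : forall i k, exists H : graph, L i k H)
    (L_size : forall i k (H : graph), L i k H -> 1 <= #|H| <= h)
    (L_complete_free : forall (i : 'I_c) (X : {set V}),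
        ~ list_complete (L i) (induced (G i) X)) :
  exists P : 'I_n -> {set V},
    \bigcup_(j < n) P j = [set: V] /\
    forall j : 'I_n,
      #|P j| = 1 \/
      exists (i : 'I_c) (k : 'I_(s i)),
        class_free (induced (G i) (P j)) (L i k).
Proof.
have bound_gt0 : 0 < c ^ (tau c h t * c * (t - 1)) by rewrite expn_gt0 ltnW.
have [Ps [sz gd sub]] : covered (good G L) n [set: V].
  apply: contrapT => nV.
  suff [i /joinable_list_complete[X]] :
      exists i, joinable (G i) (L i) (enum 'I_(s i)) [set: V].
    exact: L_complete_free.
  case: (ltnP 1 h) => [h_gt1|h_le1].
    apply: (not_covered_joinable (n := c * t)
      (ks := fun i => enum 'I_(s i)) L_nonempty L_size hc hG hh).
      under eq_bigr do rewrite size_enum_ord.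
      rewrite -[X in X * t]card_ord -sum_nat_const.
      by apply: leq_sum => i _; have /andP[] := hs i.
    move=> cV; apply: nV; apply: covered_sub cV => //.
    by have := level_lt_bound hc h_gt1 ht; lia.
  have h1 : h = 1 by lia.
  have [||i [xs [_ sz pw]]] := @ramsey_seq c V (fun i => adj (G i))
      (fun i => (s i).-1) (enum V) hc.
  - apply: sub_pairwise (_ : pairwise (fun x y => x != y) _); last first.
      by rewrite -uniq_pairwise enum_uniq.
    by move=> x y /hG[i xy]; apply/existsP; exists i.
  - rewrite -cardE leqNgt; apply/negP => V_lt; apply: nV.
    apply: covered_sub (covered_card (good1 G L) _) => //.
    rewrite cardsT hn leq_subRL // add1n; apply: leq_trans V_lt _.
    rewrite /tau h1 muln1 subnn expn0 mul1n leq_exp2l //.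
    rewrite -[X in X * _]card_ord -sum_nat_const; apply: leq_sum => i _.
    by have := hs i; lia.
  exists i; apply: (clique_joinable L_nonempty L_size h_le1 _ pw) => //.
    by rewrite sz size_enum_ord prednK //; have /andP[] := hs i.
  by move=> v _; rewrite inE.
(* If there are fewer than [n] sets, then the others are empty; the empty set is free
   of every class, as the members of the classes are nonnull. *)
exists (fun j => nth set0 Ps j); split=> [|j].
  apply/setP => v; rewrite inE; apply/bigcupP.
  have := subsetP sub v; rewrite inE => /(_ isT).
  rewrite bigcup_seq => /bigcupP[P PPs vP].
  have lt_n : index P Ps < n by apply: leq_trans sz; rewrite index_mem.
  by exists (Ordinal lt_n) => //=; rewrite nth_index.
case: (ltnP j (size Ps)) => [j_lt|j_ge]; first exact/gd/mem_nth.
rewrite nth_default //; right.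
have i : 'I_c := Ordinal (ltnW hc).
have k : 'I_(s i) by exists 0; have /andP[] := hs i.
exists i, k => H /L_size/andP[/card_gt0P[u _] _] [X [f [[g _ _] _]]].
by have := valP (val (g u)); rewrite inE.
Qed.
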